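(* Let $G=(V,E)$ be a finite, connected graph that is not balanced-bipartite, with $V=[m]=\{1,\dots,m\}$. Then there exists a deterministic point $v=v(G)\in\mathbb{R}^m$, depending only on $G$, such that the vector of proportions of balls $x(n)=(x_1(n),\dots,x_m(n))$ of the urn process on $G$ converges to $v$ almost surely as $n\to\infty$.
   Context: Balanced-bipartite: a graph $G=(V,E)$ is called balanced-bipartite if there is a bipartition $V=A\cup B$ (disjoint union, every edge joining a vertex of $A$ to a vertex of $B$) with $\#A=\#B$. Urn process on $G$: let $G=(V,E)$ be a finite connected (simple) graph with $V=[m]$ and $|E|=N$. On each vertex $i$ there is a bin initially containing $B_i(0)\ge 1$ balls ($B_i(0)$ a deterministic integer). At each step $n\ge 1$, for each edge $\{i,j\}\in E$ one ball is added either to bin $i$ or to bin $j$; given the history up to step $n-1$, the conditional probability that the ball of edge $\{i,j\}$ is added to $i$ is $$\frac{B_i(n-1)}{B_i(n-1)+B_j(n-1)},$$ where $B_i(n-1)$ is the number of balls in bin $i$ after step $n-1$. Let $N_0=\sum_{i=1}^m B_i(0)$ and $$x_i(n)=\frac{B_i(n)}{N_0+nN},\qquad i\in[m],\qquad x(n)=(x_1(n),\dots,x_m(n)).$$ *)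

(* Defs.v *)
From HB Require Import structures.
From mathcomp Require Import all_boot all_order all_algebra.
From mathcomp Require Import all_classical all_reals all_analysis.
Import Order.TTheory GRing.Theory Num.Theory.
Import numFieldNormedType.Exports.

Set Implicit Arguments.
Unset Strict Implicit.
Unset Printing Implicit Defensive.

Local Open Scope ring_scope.

(** Finite simple graphs, given by their adjacency relation [e]. *)

Definition simple_graph (V : finType) (e : rel V) : Prop :=
  symmetric e /\ irreflexive e.

Definition connected_graph (V : finType) (e : rel V) : Prop :=
  forall i j : V, connect e i j.

Definition balanced_bipartite (V : finType) (e : rel V) : Prop :=
  exists A B : {set V},
    [/\ A :|: B = [set: V]%SET, A :&: B = finset.set0, #|A| = #|B| &
        forall i j : V, e i j ->
          (i \in A) && (j \in B) || (i \in B) && (j \in A)].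

Definition edges (V : finType) (e : rel V) : {set {set V}} :=
  [set [set p.1; p.2]%SET | p : V * V & e p.1 p.2]%SET.

(** A trajectory [h] of the urn process records where the balls go: [h n a] is
    the endpoint of the edge [a] that receives its ball at step [n.+1].  Values
    of [h n] outside [edges e] are irrelevant. *)

Definition trajectory (V : finType) := nat -> {set V} -> V.

Definition balls (V : finType) (e : rel V) (B0 : V -> nat) (h : trajectory V)
    (n : nat) (i : V) : nat :=
  (B0 i + \sum_(k < n) #|[set a in edges e | h k a == i]%SET|)%N.

Definition proportions (R : realType) (m : nat) (e : rel 'I_m) (B0 : 'I_m -> nat)
    (h : trajectory 'I_m) (n : nat) : 'rV[R]_m :=
  \row_i ((balls e B0 h n i)%:R
          / (\sum_(j < m) B0 j + n * #|edges e|)%N%:R).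

Definition cond_prob (R : realType) (d : measure_display)
    (T : measurableType d) (P : probability T R) (A C : set T) : R :=
  fine (P (A `&` C)%classic) / fine (P C).

Section urn_process.
Context (V : finType) (e : rel V) (B0 : V -> nat).
Context (R : realType) (d : measure_display) (T : measurableType d).
Context (P : probability T R).
Implicit Types (D : T -> trajectory V) (h : trajectory V).

Definition goes_to D (n : nat) (a : {set V}) (i : V) : set T :=
  [set w | D w n a = i]%classic.

(** The event that the first [n] steps have been those of [h]. *)
Definition history D (n : nat) h : set T :=
  [set w | forall k a, (k < n)%N -> a \in edges e -> D w k a = h k a]%classic.

(** Only the law of each single ball given the whole past is prescribed: the
    joint law of the balls added during one step (one ball per edge) is
    arbitrary.  As there are finitely many histories up to a given step, the
    conditional probabilities are the elementary ones. *)
Record is_urn_process D : Prop := IsUrnProcess {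
  urn_measurable : forall n a i,
    a \in edges e -> measurable (goes_to D n a i);
  urn_endpoint : forall w n a, a \in edges e -> D w n a \in a;
  urn_cond_prob : forall n h i j, e i j ->
    (0 < P (history D n h))%E ->
    cond_prob P (goes_to D n [set i; j]%SET i) (history D n h) =
      (balls e B0 h n i)%:R
      / ((balls e B0 h n i)%:R + (balls e B0 h n j)%:R)
}.

End urn_process.

(* Main.v *)
(** Let [x] be the vector of proportions, [S] the total number of balls and [N]
    the number of edges.  A maximizer [v] of [prod_{ij} (x_i + x_j)] over the
    simplex satisfies [sum_{j ~ i} 1 / (v_i + v_j) <= N] for all [i].  The
    relative entropy [sum_i v_i ln x_i] is then a strict Lyapunov function on
    the whole simplex, even near the other equilibria: up to an error summable
    along every path, its expected increment is at least a constant times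
    [(1 / S) sum_{ij} ((x_i + x_j) - (v_i + v_j)) ^ 2].  As it is bounded above,
    the sum of these quantities over time has finite expectation, hence is
    almost surely finite.  Since [x] moves by [O(1 / S)] in one step and
    [1 / S] is not summable, [x_i + x_j] tends to [v_i + v_j] on every edge.
    On a connected graph that is not balanced-bipartite, the edge sums together
    with the total mass [1] determine [x]. *)

Require Import Defs.
From HB Require Import structures.
From mathcomp Require Import all_boot all_order all_algebra.
From mathcomp Require Import all_classical all_reals all_analysis.
From mathcomp Require Import measurable_realfun.
From mathcomp Require Import ring lra.
Import Order.TTheory GRing.Theory Num.Theory.
Import numFieldNormedType.Exports.

Set Implicit Arguments.
Unset Strict Implicit.
Unset Printing Implicit Defensive.

Local Open Scope classical_set_scope.
Local Open Scope ring_scope.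

(** * Existence of the equilibrium *)

(** Each further factor multiplies the old error by at most [1 + |a i|] and adds the single term
    [h ^+ 2 * (a i * s)], so the error stays quadratic, uniformly for [h] in the unit interval. *)
Lemma prod1D_expansion (R : realFieldType) (I : Type) (r : seq I) (P : pred I)
    (a : I -> R) :
  exists2 C, 0 <= C & forall h, 0 <= h <= 1 ->
    `|\prod_(i <- r | P i) (1 + h * a i) - 1 - h * \sum_(i <- r | P i) a i|
    <= C * h ^+ 2.
Proof.
elim: r => [|i r [C C0 IH]].
  by exists 0 => // h _; rewrite !big_nil mulr0 subrr subr0 normr0 mul0r.
case: (boolP (P i)) => Pi; last first.
  by exists C => // h /IH; rewrite !big_cons (negbTE Pi).
pose s := \sum_(i <- r | P i) a i.
exists (C * (1 + `|a i|) + `|a i * s|).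
  by rewrite addr_ge0// mulr_ge0// addr_ge0.
move=> h /[dup] h01 /andP[h0 h1]; rewrite !big_cons Pi -/s.
set p := \prod_(_ <- _ | _) _.
have -> : (1 + h * a i) * p - 1 - h * (a i + s) =
    (p - 1 - h * s) * (1 + h * a i) + h ^+ 2 * (a i * s) by ring.
rewrite (le_trans (ler_normD _ _))// [leRHS]mulrDl lerD//; last first.
  by rewrite normrM ger0_norm ?sqr_ge0// mulrC.
rewrite normrM mulrAC ler_pM//; first exact: IH.
rewrite (le_trans (ler_normD _ _))// normr1 lerD2l normrM ger0_norm//.
by rewrite ler_piMl.
Qed.

(** The sum is the derivative of the product at [h = 0]; were it positive, the product would exceed
    1 for small [h]. *)
Lemma sum_le0_of_prod1D_le1 (R : realFieldType) (I : Type) (r : seq I)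
    (P : pred I) (a : I -> R) :
  (forall h, 0 <= h <= 1 -> \prod_(i <- r | P i) (1 + h * a i) <= 1) ->
  \sum_(i <- r | P i) a i <= 0.
Proof.
move=> prod_le1; have [C C0 expansion] := prod1D_expansion r P a.
set s := \sum_(_ <- _ | _) _; rewrite leNgt; apply/negP => s0.
(* Small enough that the error [C * h ^+ 2] is less than the linear gain [h * s]. *)
pose h := Num.min 1 (s / (2 * (C + 1))).
have C1 : 0 < C + 1 by rewrite ltr_wpDl.
have h0 : 0 < h by rewrite lt_min ltr01 divr_gt0// mulr_gt0.
have h1 : 0 <= h <= 1 by rewrite ltW//= ge_min lexx.
have := expansion _ h1; have := prod_le1 _ h1; rewrite -/s.
set p := \prod_(_ <- _ | _) _ => p1; rewrite ler_norml => /andP[+ _].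
rewrite expr2 => low.
have : h * s <= h * (C * h) by lra.
rewrite ler_pM2l// => sCh.
have : h <= s / (2 * (C + 1)) by rewrite ge_min lexx orbT.
rewrite ler_pdivlMr ?mulr_gt0// => hs.
nra.
Qed.

Definition simplex (R : realType) (m : nat) : set 'rV[R]_m :=
  [set x | (forall i, 0 <= x ord0 i) /\ \sum_i x ord0 i = 1].

Lemma simplex_le1 (R : realType) (m : nat) (x : 'rV[R]_m) i :
  simplex x -> x ord0 i <= 1.
Proof. by case=> x0 <-; rewrite (bigD1 i)//= lerDl sumr_ge0. Qed.

Lemma compact_simplex (R : realType) (m : nat) : compact (@simplex R m).
Proof.
pose cube : set 'rV[R]_m := [set x | forall i, `[0%R, 1%R]%classic (x ord0 i)].
have cube_compact : compact cube.
  exact: (@rV_compact R m (fun=> `[0%R, 1%R]%classic)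
    (fun=> @segment_compact R 0 1)).
apply: (subclosed_compact _ cube_compact); last first.
  move=> x sx i /=; rewrite in_itv/= simplex_le1// andbT.
  by case: sx.
have -> : @simplex R m =
    (\bigcap_(i in [set: 'I_m])
      (fun x : 'rV[R]_m => x ord0 i) @^-1` [set y | 0 <= y])
    `&` (fun x : 'rV[R]_m => \sum_i x ord0 i) @^-1` [set y | y = 1].
  apply/seteqP; split => x /=.
    by case=> x0 x1; split=> // i _; exact: x0.
  by case=> x0 x1; split=> // i; exact: x0.
apply: closedI.
  apply: closed_bigI => i _; apply: closed_comp; last exact: closed_ge.
  by move=> x _; exact: coord_continuous.
apply: closed_comp; last exact: closed_eq.
move=> x _.
apply: (@continuous_big _ _ _ _ _ _ _ _ (fun i (y : 'rV[R]_m) => y ord0 i))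
  => [|i _].
  exact: add_continuous.
exact: coord_continuous.
Qed.

(* [v] maximizes the product of the edge sums over the simplex; the inequality
   is the first-order condition towards the vertex [i]. *)
Lemma exists_equilibrium (R : realType) (m : nat) (e : rel 'I_m) (i0 : 'I_m) :
  symmetric e -> irreflexive e ->
  exists v : 'rV[R]_m, [/\ simplex v,
    forall i j, e i j -> 0 < v ord0 i + v ord0 j &
    forall i, 2 * \sum_(j | e i j) (v ord0 i + v ord0 j)^-1
      <= (\sum_i \sum_(j | e i j) 1%N)%N%:R].
Proof.
move=> esym eirr.
pose s (x : 'rV[R]_m) (p : 'I_m * 'I_m) := x ord0 p.1 + x ord0 p.2.
(* The product runs over ordered pairs, so each edge factor is squared; hence the 2 in the
   first-order condition. *)
pose f (x : 'rV[R]_m) : R := \prod_(p | e p.1 p.2) s x p.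
pose u : 'rV[R]_m := const_mx (m%:R^-1).
have m0 : 0 < m%:R :> R by rewrite ltr0n; case: (m) i0 => [[]|].
have u_simplex : simplex u.
  split=> [i|]; first by rewrite mxE invr_ge0 ltW.
  rewrite (eq_bigr (fun=> m%:R^-1)) => [|i _]; last by rewrite mxE.
  by rewrite sumr_const card_ord -[LHS]mulr_natl divff// gt_eqF.
have fcont : {within @simplex R m, continuous f}.
  apply: continuous_subspaceT => x.
  apply: (@continuous_big _ _ _ _ _ _ _ _ (fun p (y : 'rV[R]_m) => s y p))
    => [|p _ y].
    exact: mul_continuous.
  exact: (cvgD (@coord_continuous R 1 m ord0 p.1 y)
    (@coord_continuous R 1 m ord0 p.2 y)).
have [v /set_mem sv vmax] := @EVT_max_rV R m f (@simplex R m)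
  (ex_intro _ _ u_simplex) (@compact_simplex R m) fcont.
(* The uniform point has a positive product, so no edge sum vanishes at the maximizer. *)
have fv0 : 0 < f v.
  apply: lt_le_trans (vmax u _); last exact/mem_set.
  by apply: prodr_gt0 => p _; rewrite /s !mxE addr_gt0// invr_gt0.
have [v0 v1] := sv.
have sv0 i j : e i j -> 0 < v ord0 i + v ord0 j.
  move=> eij; rewrite lt_neqAle addr_ge0// andbT; apply/eqP => s0.
  move: fv0; rewrite /f (bigD1 (i, j))//= {1}/s/= -s0 mul0r ltxx//.
exists v; split=> // i.
(* Moving from [v] a fraction [h] of the way to the vertex [i] multiplies the factor of [p] by
   [1 + h * a p]. *)
pose a p := ((p.1 == i)%:R + (p.2 == i)%:R) / s v p - 1.
have : \sum_(p | e p.1 p.2) a p <= 0.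
  apply: sum_le0_of_prod1D_le1 => h /andP[h0 h1].
  pose y : 'rV[R]_m := \row_k ((1 - h) * v ord0 k + h * (k == i)%:R).
  have sy : simplex y.
    split=> [k|].
      by rewrite mxE addr_ge0// mulr_ge0// subr_ge0.
    under eq_bigr do rewrite mxE.
    rewrite big_split/= -!mulr_sumr v1 (bigD1 i)//= eqxx big1 ?addr0 ?mulr1.
      by rewrite subrK.
    by move=> k /negbTE ->.
  have /mem_set/vmax := sy.
  have -> : f y = f v * \prod_(p | e p.1 p.2) (1 + h * a p).
    rewrite /f -big_split/=; apply: eq_bigr => -[j k]/= ejk.
    rewrite /a /s/= !mxE; have := sv0 _ _ ejk; move=> ?.
    by field; rewrite gt_eqF.
  by rewrite ger_pMr.
rewrite big_split/= sumrN subr_le0.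
rewrite -(pair_big_dep xpredT e
  (fun j k => ((j == i)%:R + (k == i)%:R) / s v (j, k)))/=.
rewrite -(pair_big_dep xpredT e (fun j k => 1))/=.
have -> : \sum_j \sum_(k | e j k) 1 = (\sum_i \sum_(j | e i j) 1%N)%N%:R :> R.
  by rewrite natr_sum; apply: eq_bigr => j _; rewrite natr_sum.
apply: le_trans; rewrite le_eqVlt; apply/orP; left; apply/eqP.
(* By symmetry of [e], pairs starting at [i] and pairs ending at [i] contribute equally. *)
under [RHS]eq_bigr => j _.
  under eq_bigr do rewrite mulrDl.
  rewrite big_split/=.
  over.
rewrite big_split/= mulr_natl mulr2n; congr (_ + _).
  rewrite [RHS](bigD1 i)//=.
  rewrite [X in _ + X]big1 ?addr0 => [|j /negbTE ji]; last first.
    by apply: big1 => k _; rewrite ji mul0r.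
  by apply: eq_bigr => k _; rewrite eqxx mul1r.
under [RHS]eq_bigr do rewrite big_mkcond/=.
rewrite exchange_big/= [RHS](bigD1 i)//=.
rewrite [X in _ + X]big1 ?addr0 => [|j /negbTE ji]; last first.
  by apply: big1 => k _; rewrite ji mul0r if_same.
rewrite [LHS]big_mkcond/=; apply: eq_bigr => k _; rewrite eqxx mul1r esym.
by rewrite /s/= addrC.
Qed.

(** * Deterministic convergence criteria *)

(** The cube is the power whose increments carry a factor quadratic in the values, matching the
    weighted sum of squares assumed summable below. *)
Lemma norm_cube_diff_le (R : realFieldType) (a b : R) :
  `|a ^+ 3 - b ^+ 3| <= 2 * `|a - b| * (a ^+ 2 + b ^+ 2).
Proof.
have -> : a ^+ 3 - b ^+ 3 = (a - b) * (a ^+ 2 + a * b + b ^+ 2) by ring.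
rewrite normrM mulrAC [leRHS]mulrC ler_wpM2l//.
have := sqr_ge0 (a + b); have := sqr_ge0 (a - b).
by move=> ? ?; rewrite ger0_norm; nra.
Qed.

(* The cubes have summable increments, so they converge; a nonzero limit
   would make [sum g] comparable to [sum g f^2]. *)
Lemma cvg0_of_slow_variation (R : realType) (g f : R ^nat) (c C : R) :
  (forall k, 0 < g k) -> (forall k, g k <= c * g k.+1) ->
  ~ cvgn (series g) ->
  (forall k, `|f k.+1 - f k| <= C * g k) ->
  cvgn (series (fun k => g k * f k ^+ 2)) ->
  f @ \oo --> 0.
Proof.
move=> g0 gc gdvg fC cvg_gf.
have C0 : 0 <= C by have := le_trans (normr_ge0 _) (fC 0%N); rewrite pmulr_lge0.
pose q k := g k * f k ^+ 2.
have q0 k : 0 <= q k by rewrite mulr_ge0 ?sqr_ge0// ltW.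
(* The cube increment also involves [g k * f k.+1 ^+ 2], which [g k <= c * g k.+1] bounds by the
   shifted term. *)
have cvg_qS : cvgn (series (fun k => q k.+1)).
  move/cvg_ex: (cvg_gf) => [l ql].
  apply/cvg_ex; exists (l - q 0%N).
  have -> : series (fun k => q k.+1) = (fun n => series q n.+1 - q 0%N).
    by apply/funext => n; rewrite /series/= big_nat_recl// addrAC subrr add0r.
  by apply: cvgB; [rewrite (cvg_shiftS (series q))|exact: cvg_cst].
pose u k := f k ^+ 3.
have : cvgn [normed series (telescope u)].
  apply: (@series_le_cvg _ _ (2 * C *: (q + c *: (fun k => q k.+1)))) => //.
  - by move=> k /=.
  - move=> k; change (0 <= 2 * C * (q k + c * q k.+1)).
    rewrite !mulr_ge0// addr_ge0//= mulr_ge0//.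
    by rewrite -(pmulr_lge0 _ (g0 k.+1)) (le_trans _ (gc k))// ltW.
  - move=> k /=; rewrite (le_trans (norm_cube_diff_le _ _))//.
    change (2 * `|f k.+1 - f k| * (f k.+1 ^+ 2 + f k ^+ 2) <=
      2 * C * (q k + c * q k.+1)).
    apply: (@le_trans _ _ (2 * (C * g k) * (f k.+1 ^+ 2 + f k ^+ 2))).
      by rewrite ler_wpM2r ?addr_ge0 ?sqr_ge0// ler_wpM2l.
    have -> : 2 * (C * g k) * (f k.+1 ^+ 2 + f k ^+ 2) =
      2 * C * (q k + g k * f k.+1 ^+ 2) by rewrite /q; ring.
    rewrite ler_wpM2l ?mulr_ge0// lerD2l /q mulrA ler_wpM2r ?sqr_ge0//.
  - apply: is_cvg_seriesZ; apply: is_cvg_seriesD => //.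
    exact: is_cvg_seriesZ.
move=> cvg_norm_u.
have [l cvg_u] : exists l : R, u @ \oo --> l.
  exists (u 0%N + limn (series (telescope u))).
  rewrite [X in X @ _ --> _](_ : u = (fun n => u 0%N + series (telescope u) n)).
    apply: cvgD; first exact: cvg_cst.
    exact: (@normed_cvg R R^o (telescope u) cvg_norm_u).
  by apply/funext => n; rewrite [LHS]eq_sum_telescope.
have [l0|l0] := eqVneq l 0.
  rewrite l0 in cvg_u; apply/cvgr0Pnorm_lt => eps eps0.
  have eps3 : 0 < eps ^+ 3 by rewrite exprn_gt0.
  have small : \forall n \near \oo, `|u n| < eps ^+ 3.
    by move/cvgr0Pnorm_lt: cvg_u; exact.
  apply: filterS small => n.
  by rewrite normrX ltr_pXn2r// nnegrE ltW.
exfalso; apply: gdvg.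
(* If [f k ^+ 2] were below both 1 and [|l| / 2], then [|f k| ^+ 3 <= f k ^+ 2 < |l| / 2], which
   fails once [u k] is close to [l]. *)
pose del := Num.min 1 (`|l| / 2).
have del0 : 0 < del by rewrite lt_min ltr01 divr_gt0 ?normr_gt0.
have [N _ fN] : \forall k \near \oo, del <= f k ^+ 2.
  have : `|l| / 2 < `|l| by rewrite ltr_pdivrMr// ltr_pMr ?normr_gt0// ltr1n.
  move=> /(cvgr_gt _ (cvg_norm cvg_u)); apply: filterS => k.
  rewrite /u normrX => lu; rewrite leNgt; apply/negP.
  rewrite lt_min => /andP[]; rewrite -real_normK ?num_real// expr2 => f1 fl.
  have := normr_ge0 (f k) => f0; move: lu; rewrite !exprS expr0; nra.
rewrite -(is_cvg_series_restrict N).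
have : cvgn [sequence \sum_(N <= k < n) (del^-1 *: q) k]_n.
  by rewrite is_cvg_series_restrict; exact: is_cvg_seriesZ.
set G := fun n => \sum_(N <= k < n) g k => cvg_q.
have Gnd : nondecreasing_seq G.
  apply/nondecreasing_seqP => n; have [Nn|nN] := leqP N n.
    by rewrite /G big_nat_recr//= lerDl ltW.
  by rewrite /G !big_geq// ltnW.
apply: nondecreasing_is_cvgn => //.
have [M qM] := cvg_has_ub cvg_q.
exists M => _ [n _ <-]; apply: le_trans (qM _ (ex_intro2 _ _ n I erefl)).
apply: le_trans (ler_norm _); rewrite /G/= big_nat [leRHS]big_nat.
apply: ler_sum => k /andP[Nk _].
change (g k <= del^-1 * (g k * f k ^+ 2)).
by rewrite ler_pdivlMl// mulrC ler_pM2l//; exact: fN.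
Qed.

Lemma cvg_rVP (R : realType) (m : nat) (x : nat -> 'rV[R]_m) (v : 'rV[R]_m) :
  (forall i, x n ord0 i @[n --> \oo] --> v ord0 i) -> x @ \oo --> v.
Proof.
move=> xv; apply/cvg_ballP => eps eps0.
have : \forall n \near \oo, forall i, ball (v ord0 i) eps (x n ord0 i).
  by apply: filter_forall => i; exact: (cvg_ball (xv i)).
apply: filterS => n xn; split => // i j; rewrite (ord1 i); exact: xn.
Qed.

(** * Recovering the coordinates from the edge sums *)

Section edge_sums.
Context (R : realType) (V : finType) (e : rel V).
Context (u : V -> R ^nat).
Hypothesis sum_u : forall n, \sum_i u i n = 0.
Hypothesis edge_sum_cvg0 :
  forall i j, e i j -> (fun n => u i n + u j n) @ \oo --> (0 : R).

Let sgn (b : bool) : R := (-1) ^+ b.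

(** Each edge of a path flips the asymptotic sign, so the bit is the parity of the path. *)
Lemma connect_alternating (r i : V) : connect e r i ->
  exists b : bool, (fun n => u i n - sgn b * u r n) @ \oo --> (0 : R).
Proof.
case/connectP => p; elim/last_ind: p i => [i _ ->|p j IH i].
  exists false; under eq_fun do rewrite /sgn expr0 mul1r subrr.
  exact: cvg_cst.
rewrite rcons_path last_rcons => /andP[pth ej] ->.
have [b ub] := IH _ pth erefl; exists (~~ b).
have -> : (fun n => u j n - sgn (~~ b) * u r n) =
    (fun n => (u (last r p) n + u j n) - (u (last r p) n - sgn b * u r n)).
  by apply/funext => n; rewrite /sgn signrN; ring.
by rewrite -(subrr (0 : R)); apply: cvgB => //; exact: edge_sum_cvg0.
Qed.

Lemma edge_sums_cvg0 : connected_graph e -> ~ balanced_bipartite e ->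
  forall i, u i @ \oo --> (0 : R).
Proof.
move=> conn nbb r.
have /choice[b ub] : forall i, exists b : bool,
    (fun n => u i n - sgn b * u r n) @ \oo --> (0 : R).
  by move=> i; exact/connect_alternating/conn.
have cvg_mul (a : R) : a != 0 -> (fun n => a * u r n) @ \oo --> (0 : R) ->
    u r @ \oo --> (0 : R).
  move=> a0 au; rewrite (_ : u r = (fun n => a^-1 * (a * u r n))).
    by rewrite -(mulr0 a^-1); apply: cvgM => //; exact: cvg_cst.
  by apply/funext => n; rewrite mulKf.
(* An edge whose ends carry the same sign makes [2 * u r] vanish in the limit. *)
have [[[i j] /= eij /eqP bij]|no_edge] := pselect (exists2 p : V * V,
    e p.1 p.2 & b p.1 == b p.2).
  apply: (cvg_mul (2 * sgn (b i))).
    by rewrite mulf_neq0// ?pnatr_eq0// signr_eq0.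
  have -> : (fun n => 2 * sgn (b i) * u r n) =
     (fun n => (u i n + u j n) - (u i n - sgn (b i) * u r n)
        - (u j n - sgn (b j) * u r n)).
    by apply/funext => n; rewrite -bij; ring.
  rewrite -(subrr (0 : R)) -{1}(subrr (0 : R)).
  by apply: cvgB => //; apply: cvgB => //; exact: edge_sum_cvg0.
(* Otherwise the signs form a bipartition. The zero total gives that the sum of signs times [u r]
   tends to 0, and the sum of signs is nonzero because the classes differ in size. *)
apply: (cvg_mul (- \sum_i sgn (b i))).
  rewrite oppr_eq0; apply/eqP => sum0; apply: nbb.
  exists [set i | b i]%SET, [set i | ~~ b i]%SET; split.
  - by apply/setP => i; rewrite !inE orbN.
  - by apply/setP => i; rewrite !inE andbN.
  - move: sum0; rewrite (bigID b)/=.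
    rewrite (eq_bigr (fun=> -1)) => [|i ->//]; rewrite sumr_const.
    rewrite (eq_bigr (fun=> 1)) => [|i /negbTE ->//]; rewrite sumr_const.
    rewrite mulNrn addrC => /eqP; rewrite subr_eq0 eqr_nat => /eqP cards.
    by rewrite !cardsE.
  - move=> i j eij; rewrite !inE.
    have : b i != b j by apply/negP => bij; apply: no_edge; exists (i, j).
    by case: (b i); case: (b j).
have -> : (fun n => - (\sum_i sgn (b i)) * u r n) =
    (fun n => \sum_i (u i n - sgn (b i) * u r n)).
  apply/funext => n; rewrite big_split/= sum_u add0r mulNr mulr_suml.
  by rewrite sumrN.
suff : \sum_i (u i n - sgn (b i) * u r n) @[n --> \oo] --> \sum_(i : V) (0 : R).
  by rewrite big1.
apply: cvg_big => [|i _]; [exact: add_continuous|exact: ub].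
Qed.

End edge_sums.

(** * Edges and balls *)

Section edge_counting.
Context (V : finType) (e : rel V).
Hypothesis e_simple : simple_graph e.

(** Without loops, the edges at [i] correspond bijectively to the neighbours of [i]; this passes
    from edges as sets to sums over adjacent pairs. *)
Lemma card_edges_to (f : {set V} -> V) (i : V) :
  (forall a, a \in edges e -> f a \in a) ->
  #|[set a in edges e | f a == i]%SET| =
    (\sum_(j | e i j) (f [set i; j]%SET == i))%N.
Proof.
have [_ eirr] := e_simple; move=> fP.
have -> : [set a in edges e | f a == i]%SET =
    [set [set i; j] | j in [set j | e i j && (f [set i; j]%SET == i)]]%SET.
  apply/setP => a; rewrite !inE; apply/andP/imsetP => [[aE /eqP fai]|[j]].
    have := fP _ aE; rewrite fai; case/imsetP: aE => -[j k] /=.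
    rewrite inE/= => ejk ajk; rewrite ajk !inE => /orP[]/eqP ijk.
      by exists k; rewrite ?inE ijk// -ajk -ijk fai eqxx andbT ijk.
    exists j; last by rewrite ijk finset.setUC.
    by rewrite inE ijk (proj1 e_simple) ejk finset.setUC -ajk fai ijk eqxx.
  rewrite inE => /andP[eij fij] ->; split=> //.
  by apply/imsetP; exists (i, j); rewrite ?inE.
rewrite card_in_imset => [|j k].
  by rewrite -sum1dep_card big_mkcondr/=; apply: eq_bigr => j _; case: eqP.
rewrite !inE => /andP[eij _] _ eq_jk.
have : j \in [set i; k]%SET by rewrite -eq_jk !inE eqxx orbT.
by rewrite !inE => /orP[]/eqP // ji; rewrite ji eirr in eij.
Qed.

Lemma sum_card_edges_to (f : {set V} -> V) :
  (\sum_i #|[set a in edges e | f a == i]%SET| = #|edges e|)%N.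
Proof.
rewrite -[RHS]sum1_card (partition_big f xpredT)//=.
by apply: eq_bigr => i _; rewrite -sum1dep_card.
Qed.

(* Any choice of an endpoint for each edge splits the ordered pairs of
   adjacent vertices into those oriented by the choice and their reversals. *)
Lemma sum_adjacent_pairs (i0 : V) :
  (\sum_i \sum_(j | e i j) 1 = 2 * #|edges e|)%N.
Proof.
have [esym eirr] := e_simple.
pose f (a : {set V}) := odflt i0 [pick x in a].
have fP a : a \in edges e -> f a \in a.
  case/imsetP => -[j k] _ -> /=; rewrite /f; case: pickP => //= /(_ j).
  by rewrite !inE eqxx.
have sum_to : (\sum_i \sum_(j | e i j) (f [set i; j]%SET == i) = #|edges e|)%N.
  rewrite -(sum_card_edges_to f); apply: eq_bigr => i _.
  by rewrite card_edges_to.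
have sum_from : (\sum_i \sum_(j | e i j) (f [set i; j]%SET == j) = #|edges e|)%N.
  rewrite -sum_to; under eq_bigr do rewrite big_mkcond/=.
  rewrite exchange_big/=; apply: eq_bigr => i _; rewrite [RHS]big_mkcond/=.
  by apply: eq_bigr => j _; rewrite esym finset.setUC.
rewrite mul2n -addnn -{1}sum_to -{1}sum_from -big_split/=.
apply: eq_bigr => i _; rewrite -big_split/=; apply: eq_bigr => j eij.
have : [set i; j]%SET \in edges e by apply/imsetP; exists (i, j); rewrite ?inE.
move/fP; rewrite !inE => /orP[]/eqP ->; rewrite eqxx.
  by case: eqP => // ij; rewrite ij eirr in eij.
by case: eqP => // ij; rewrite ij eirr in eij.
Qed.

Lemma sum_balls (B0 : V -> nat) (h : trajectory V) (n : nat) :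
  (\sum_i balls e B0 h n i = \sum_i B0 i + n * #|edges e|)%N.
Proof.
rewrite big_split/= exchange_big/=; congr addn.
under eq_bigr do rewrite sum_card_edges_to.
by rewrite sum_nat_const card_ord.
Qed.

End edge_counting.

Lemma ballsS (V : finType) (e : rel V) (B0 : V -> nat) (h : trajectory V) n i :
  balls e B0 h n.+1 i =
    (balls e B0 h n i + #|[set a in edges e | h n a == i]%SET|)%N.
Proof. by rewrite /balls big_ord_recr addnA. Qed.

Lemma balls_ge1 (V : finType) (e : rel V) (B0 : V -> nat) (h : trajectory V) n i :
  (forall i, (1 <= B0 i)%N) -> (1 <= balls e B0 h n i)%N.
Proof. by move=> B1; rewrite (leq_trans (B1 i))// leq_addr. Qed.

(** * The drift inequality at an equilibrium *)

Section equilibrium_gap.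
Context (R : realFieldType) (V : finType) (e : rel V).
Context (v x : V -> R).
Hypotheses (e_sym : symmetric e).
Hypotheses (v_le1 : forall i, v i <= 1) (x_le1 : forall i, x i <= 1).
Hypotheses (x_ge0 : forall i, 0 <= x i) (sum_x : \sum_i x i = 1).
Hypotheses (v_gt0 : forall i j, e i j -> 0 < v i + v j).
Hypotheses (x_gt0 : forall i j, e i j -> 0 < x i + x j).

Lemma sum_adjacent_symm (f : V -> R) (g : V -> V -> R) :
  (forall i j, g i j = g j i) ->
  \sum_i \sum_(j | e i j) (f i + f j) * g i j =
  2 * \sum_i \sum_(j | e i j) f i * g i j.
Proof.
move=> gC; under eq_bigr => i _.
  under eq_bigr do rewrite mulrDl.
  rewrite big_split/=.
  over.
rewrite big_split/= mulr_natl mulr2n; congr (_ + _).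
under eq_bigr do rewrite big_mkcond/=.
rewrite exchange_big/=; apply: eq_bigr => i _; rewrite [RHS]big_mkcond/=.
by apply: eq_bigr => j _; rewrite e_sym gC.
Qed.

(* With [t = v i + v j] and [s = x i + x j], the equilibrium condition on [v]
   bounds [sum s / t], and [t / s + s / t - 2 = (t - s) ^ 2 / (s t)]. *)
Lemma equilibrium_gap :
  (forall i, 2 * \sum_(j | e i j) (v i + v j)^-1
     <= (\sum_i \sum_(j | e i j) 1%N)%N%:R) ->
  8^-1 * \sum_i \sum_(j | e i j) ((x i + x j) - (v i + v j)) ^+ 2 <=
  \sum_i \sum_(j | e i j) v i / (x i + x j)
    - (\sum_i \sum_(j | e i j) 1%N)%N%:R / 2.
Proof.
move=> v_eq; set M := (\sum_i \sum_(j | e i j) 1%N)%N in v_eq *.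
have ME : M%:R = \sum_i \sum_(j | e i j) 1 :> R.
  by rewrite /M natr_sum; apply: eq_bigr => j _; rewrite natr_sum.
(* Average of the equilibrium conditions with weights [x i]. *)
have x_eq : \sum_i \sum_(j | e i j) (x i + x j) / (v i + v j) <= M%:R.
  rewrite (sum_adjacent_symm x (g := fun i j => (v i + v j)^-1)) => [|i j];
    last by rewrite addrC.
  have -> : M%:R = \sum_i x i * M%:R :> R by rewrite -mulr_suml sum_x mul1r.
  rewrite mulr_sumr; apply: ler_sum => i _.
  by rewrite -mulr_sumr mulrCA ler_wpM2l.
rewrite -(ler_pM2l (ltr0n _ 2)) mulrBr.
rewrite -(sum_adjacent_symm v (g := fun i j => (x i + x j)^-1)) => [|i j];
  last by rewrite addrC.
set A := \sum_i \sum_(j | e i j) (v i + v j) / (x i + x j).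
set B := \sum_i \sum_(j | e i j) (x i + x j) / (v i + v j) in x_eq.
set Q := \sum_i \sum_(j | e i j) ((x i + x j) - (v i + v j)) ^+ 2.
(* Since [B <= M%:R], this suffices. The constant comes from [s * t <= 4], both edge sums being at
   most 2. *)
suff : 4^-1 * Q + (M%:R + M%:R) <= A + B by move: x_eq; lra.
rewrite ME mulr_sumr -!big_split/=; apply: ler_sum => i _.
rewrite mulr_sumr -!big_split/=; apply: ler_sum => j eij.
have := v_gt0 eij; have := x_gt0 eij.
have := lerD (x_le1 i) (x_le1 j); have := lerD (v_le1 i) (v_le1 j).
move: (x i + x j) (v i + v j) => s t t2 s2 s0 t0.
have -> : t / s + s / t = t^-1 * s^-1 * (s - t) ^+ 2 + (1 + 1).
  by field; rewrite !gt_eqF.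
rewrite lerD2r ler_wpM2r ?sqr_ge0// -invfM lef_pV2 ?posrE ?mulr_gt0//.
by nra.
Qed.

End equilibrium_gap.

(** * Entropy along a trajectory *)

(** [D / B] is [D / (B + D)], at most the increment of [ln], plus [D * (1 / B - 1 / (B + D))], where
    [D <= N]; both bounds telescope. *)
Lemma div_le_ln_diff (R : realType) (B D N : R) : 0 < B -> 0 <= D <= N ->
  D / B <= (ln (B + D) - N / (B + D)) - (ln B - N / B).
Proof.
move=> B0 /andP[D0 DN]; have BD0 : 0 < B + D by rewrite ltr_wpDr.
have lnBD : D / (B + D) <= ln (B + D) - ln B.
  have : ln (1 + - (D / (B + D))) <= - (D / (B + D)).
    by apply: le_ln1Dx; rewrite ltrN2 ltr_pdivrMr// mul1r ltrDr.
  have -> : 1 + - (D / (B + D)) = B / (B + D) by field; rewrite gt_eqF.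
  by rewrite ln_div ?posrE// => ?; lra.
have : (N - D) * (B + D)^-1 <= (N - D) * B^-1.
  by rewrite ler_wpM2l ?subr_ge0// lef_pV2 ?posrE// lerDl.
by rewrite !mulrBl; lra.
Qed.

Section urn_path.
Context (R : realType) (V : finType) (e : rel V) (B0 : V -> nat).
Hypotheses (e_simple : simple_graph e) (B0_ge1 : forall i, (1 <= B0 i)%N).
Variable (i0 : V).
Implicit Types (h : trajectory V) (n k : nat) (i : V).

Definition total n : nat := (\sum_j B0 j + n * #|edges e|)%N.

Definition gain h k i : nat := #|[set a in edges e | h k a == i]%SET|.

Lemma total_gt0 n : 0 < (total n)%:R :> R.
Proof.
rewrite ltr0n /total addn_gt0 (bigD1 i0)//= addn_gt0.
by rewrite (leq_trans _ (B0_ge1 i0)).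
Qed.

Lemma balls_gt0 h n i : 0 < (balls e B0 h n i)%:R :> R.
Proof. by rewrite ltr0n balls_ge1. Qed.

Lemma balls_le_total h n i : (balls e B0 h n i <= total n)%N.
Proof. by rewrite /total -(sum_balls e B0 h) (bigD1 i)//= leq_addr. Qed.

Lemma gain_le h k i : (gain h k i <= #|edges e|)%N.
Proof. by rewrite -(sum_card_edges_to e (h k)) (bigD1 i)//= leq_addr. Qed.

Lemma totalS n : total n.+1 = (total n + #|edges e|)%N.
Proof. by rewrite /total mulSn addnAC addnA addnAC. Qed.

Lemma sum_gain_le h n i :
  \sum_(k < n) (gain h k i)%:R / (balls e B0 h k i)%:R
    <= ln (total n)%:R + #|edges e|%:R :> R.
Proof.
pose b k : R := (balls e B0 h k i)%:R; pose N : R := #|edges e|%:R.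
pose phi k := ln (b k) - N / b k.
have b1 k : 1 <= b k by rewrite ler1n balls_ge1.
have b0 k : 0 < b k by exact: balls_gt0.
have N0 : 0 <= N by [].
apply: (@le_trans _ _ (phi n - phi 0%N)).
  rewrite -telescope_sumr// big_mkord; apply: ler_sum => k _.
  rewrite /phi {1 2}/b ballsS natrD; apply: div_le_ln_diff; first exact: balls_gt0.
  by rewrite ler0n ler_nat gain_le.
have : ln (b n) <= ln (total n)%:R.
  by rewrite ler_ln ?posrE ?total_gt0// ler_nat balls_le_total.
have : 0 <= ln (b 0%N) by rewrite ln_ge0.
have : 0 <= N / b n by rewrite divr_ge0// ltW.
have : N / b 0%N <= N by rewrite ler_pdivrMr// ler_peMr.
by rewrite /phi -/N; lra.
Qed.

Lemma ln_total_le n :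
  ln (total n)%:R - ln (total 0)%:R
    <= \sum_(k < n) #|edges e|%:R / (total k)%:R :> R.
Proof.
rewrite -(telescope_sumr (fun k => ln (total k)%:R : R))// big_mkord.
apply: ler_sum => k _; have t0 := total_gt0.
rewrite -ln_div ?posrE// totalS natrD mulrDl divff ?gt_eqF//.
by apply: le_ln1Dx; rewrite (lt_le_trans (ltrN10 _))// divr_ge0// ltW.
Qed.

(** Since [v] has mass 1, the two sums grow like the same [ln (total n)], which cancels. This is the
    pathwise bound on the relative entropy. *)
Lemma potential_le (v : V -> R) h n :
  (forall i, 0 <= v i) -> \sum_i v i = 1 ->
  \sum_(k < n) (\sum_i v i * ((gain h k i)%:R / (balls e B0 h k i)%:R)
     - #|edges e|%:R / (total k)%:R) <= ln (total 0)%:R + #|edges e|%:R.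
Proof.
move=> v0 v1; rewrite sumrB exchange_big/=.
have : \sum_i \sum_(k < n) v i * ((gain h k i)%:R / (balls e B0 h k i)%:R)
    <= ln (total n)%:R + #|edges e|%:R.
  apply: (@le_trans _ _ (\sum_i v i * (ln (total n)%:R + #|edges e|%:R))).
    by apply: ler_sum => i _; rewrite -mulr_sumr ler_wpM2l// sum_gain_le.
  by rewrite -mulr_suml v1 mul1r.
by have := ln_total_le n; lra.
Qed.

Definition share h n i : R := (balls e B0 h n i)%:R / (total n)%:R.

Lemma share_gt0 h n i : 0 < share h n i.
Proof. by rewrite divr_gt0 ?balls_gt0 ?total_gt0. Qed.

Lemma sum_share h n : \sum_i share h n i = 1.
Proof. by rewrite -mulr_suml -natr_sum sum_balls divff// gt_eqF// total_gt0. Qed.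

Lemma share_le1 h n i : share h n i <= 1.
Proof. by rewrite ler_pdivrMr ?total_gt0// mul1r ler_nat balls_le_total. Qed.

Lemma share_step h n i :
  `|share h n.+1 i - share h n i| <= #|edges e|%:R / (total n)%:R.
Proof.
have S0 := total_gt0 n; have := total_gt0 n.+1.
rewrite /share ballsS -/(gain h n i) totalS (natrD _ (balls _ _ _ _ _)).
rewrite (natrD _ (total n)) => SN0.
have B0' : 0 <= (balls e B0 h n i)%:R :> R by [].
have D0 : 0 <= (gain h n i)%:R :> R by [].
have : (gain h n i)%:R <= #|edges e|%:R :> R by rewrite ler_nat gain_le.
have : (balls e B0 h n i)%:R <= (total n)%:R :> R by rewrite ler_nat balls_le_total.
move: S0 SN0 B0' D0; move: ((balls e B0 h n i)%:R : R) ((total n)%:R : R)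
  ((gain h n i)%:R : R) (#|edges e|%:R : R).
move=> B S D N S0 SN0 B0' D0 BS DN.
(* Both [D] and [N * (B / S)] lie between 0 and [N], so the numerator is at most [N] in absolute
   value. *)
have -> : (B + D) / (S + N) - B / S = (D - N * (B / S)) / (S + N).
  by field; rewrite !gt_eqF.
have BS0 : 0 <= B / S by rewrite divr_ge0// ltW.
have BS1 : B / S <= 1 by rewrite ler_pdivrMr// mul1r.
rewrite normrM normfV (gtr0_norm SN0) ler_pM ?invr_ge0//; first exact: ltW.
  rewrite ler_norml; apply/andP; split; nra.
by rewrite lef_pV2 ?posrE// lerDl (le_trans D0).
Qed.

Lemma total_series_dvg : (0 < #|edges e|)%N ->
  ~ cvgn (series (fun n => (total n)%:R^-1 : R)).
Proof.
move=> N0 cvg_total; apply: (@dvg_harmonic R).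
apply: (@series_le_cvg _ _ ((total 1)%:R *: (fun n => (total n)%:R^-1 : R))) => //.
- by move=> n; rewrite invr_ge0.
- by move=> n; change (0 <= (total 1)%:R * (total n)%:R^-1 :> R); rewrite mulr_ge0.
- move=> n /=; change (n.+1%:R^-1 <= (total 1)%:R * (total n)%:R^-1 :> R).
  rewrite ler_pdivlMr ?total_gt0// mulrC ler_pdivrMr// -natrM ler_nat.
  by rewrite /total mul1n mulnDl leq_add ?leq_pmulr// mulnC leq_mul.
- exact: is_cvg_seriesZ.
Qed.

(** As [total n >= 1], one step multiplies the total by at most [1 + #|edges e|]. *)
Lemma total_slow n :
  (total n)%:R^-1 <= (1 + #|edges e|%:R) * (total n.+1)%:R^-1 :> R.
Proof.
rewrite ler_pdivlMr ?total_gt0// mulrC ler_pdivrMr ?total_gt0//.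
rewrite totalS natrD mulrDl mul1r lerD2l ler_peMr//.
by rewrite ler1n -(ltr0n R) total_gt0.
Qed.

Lemma edge_share_cvg (v : V -> R) h i j : e i j ->
  cvgn (series (fun n => (total n)%:R^-1 *
    ((share h n i + share h n j) - (v i + v j)) ^+ 2)) ->
  (fun n => (share h n i - v i) + (share h n j - v j)) @ \oo --> (0 : R).
Proof.
move=> eij cvg_q.
have N0 : (0 < #|edges e|)%N.
  apply/card_gt0P; exists [set i; j]%SET.
  by apply/imsetP; exists (i, j); rewrite ?inE.
apply: (@cvg0_of_slow_variation _ (fun n => (total n)%:R^-1) _
  (1 + #|edges e|%:R) (2 * #|edges e|%:R)).
- by move=> n; rewrite invr_gt0 total_gt0.
- exact: total_slow.
- exact: total_series_dvg.
- move=> n; rewrite -mulrA mulr_natl mulr2n.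
  rewrite (le_trans _ (lerD (share_step h n i) (share_step h n j)))//.
  rewrite (le_trans _ (ler_normD _ _))// le_eqVlt; apply/orP; left; apply/eqP.
  by congr `|_|; ring.
- congr (cvgn (series _)): cvg_q; apply/funext => n; congr (_ * _ ^+ 2); ring.
Qed.

End urn_path.

(** * Expectations *)

Section expectation.
Context (R : realType) (d : measure_display) (T : measurableType d).
Context (P : probability T R).

Lemma Rintegral_sum (I : Type) (r : seq I) (Q : pred I) (f : I -> T -> R) :
  (forall i, Q i -> P.-integrable setT (EFin \o f i)) ->
  \int[P]_w (\sum_(i <- r | Q i) f i w) = \sum_(i <- r | Q i) \int[P]_w f i w.
Proof.
move=> intf; elim: r => [|i r IH].
  under eq_Rintegral do rewrite big_nil.
  by rewrite big_nil Rintegral_cst// mul0r.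
rewrite big_cons; case: ifPn => Qi; last first.
  by rewrite -IH; apply: eq_Rintegral => w _; rewrite big_cons (negbTE Qi).
under eq_Rintegral do rewrite big_cons Qi.
rewrite RintegralD ?IH//; first exact: intf.
apply: eq_integrable (integrable_sum measurableT r intf) => // w _ /=.
by rewrite sumEFin.
Qed.

Lemma integrable_sumR (I : Type) (r : seq I) (Q : pred I) (f : I -> T -> R) :
  (forall i, Q i -> P.-integrable setT (EFin \o f i)) ->
  P.-integrable setT (EFin \o (fun w => \sum_(i <- r | Q i) f i w)).
Proof.
move=> intf; apply: eq_integrable (integrable_sum measurableT r intf) => // w _ /=.
by rewrite sumEFin.
Qed.

Lemma Rintegral_sum_indic (I : finType) (g : I -> R) (A : I -> set T) :
  (forall i, measurable (A i)) ->
  P.-integrable setT (EFin \o (fun w => \sum_i g i * \1_(A i) w)) /\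
  \int[P]_w (\sum_i g i * \1_(A i) w) = \sum_i g i * fine (P (A i)).
Proof.
move=> mA.
have intA i : P.-integrable setT (EFin \o \1_(A i)) by exact: integrable_indic.
have intgA i : P.-integrable setT (EFin \o (fun w => g i * \1_(A i) w)).
  by apply: eq_integrable (integrableZl measurableT (g i) (intA i)) => // w _ /=.
split; first exact: integrable_sumR.
rewrite Rintegral_sum//; apply: eq_bigr => i _.
by rewrite RintegralZl// /Rintegral integral_indic// setIT.
Qed.

(** By monotone convergence the sum of the series has expectation at most [K], so it is almost
    surely finite. *)
Lemma ae_series_cvg (q : nat -> T -> R) (K : R) :
  (forall k, P.-integrable setT (EFin \o q k)) ->
  (forall k w, 0 <= q k w) ->
  (forall n, \int[P]_w (\sum_(k < n) q k w) <= K) ->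
  {ae P, forall w, cvgn (series (q^~ w))}.
Proof.
move=> intq q0 qK.
pose s w := (\sum_(0 <= k <oo) (q k w)%:E)%E.
have mq k : measurable_fun setT (fun w => (q k w)%:E).
  exact: measurable_int (intq k).
have s0 w : (0 <= s w)%E by apply: nneseries_ge0 => k _ _; rewrite lee_fin.
have ms : measurable_fun setT s.
  by apply: ge0_emeasurable_sum => // k w _ _; rewrite lee_fin.
have int_s : (\int[P]_w s w <= K%:E)%E.
  rewrite integral_nneseries//; last by move=> k w _; rewrite lee_fin.
  apply: lime_le.
    apply: is_cvg_nneseries => k _ _.
    by apply: integral_ge0 => w _; rewrite lee_fin.
  apply: nearW => n.
  rewrite big_mkord -ge0_integral_sum//; last by move=> k w _; rewrite lee_fin.
  have int_n := @integrable_sumR _ (index_enum 'I_n) xpredT (fun k => q k)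
    (fun k _ => intq k).
  have := qK n; rewrite -lee_fin /Rintegral fineK.
    by under eq_integral do rewrite -sumEFin.
  exact: integrable_fin_num int_n.
have : P.-integrable setT s.
  apply/integrableP; split=> //.
  under eq_integral do rewrite gee0_abs//.
  by rewrite (le_lt_trans int_s)// ltry.
move=> /(integrable_ae measurableT); apply: filterS => w /(_ I) s_fin.
apply: nondecreasing_is_cvgn.
  by apply: nondecreasing_series => k _ _; exact: q0.
exists (fine (s w)) => _ [n _ <-].
rewrite -lee_fin fineK// /series/= -sumEFin.
by apply: nneseries_lim_ge => k _ _; rewrite lee_fin.
Qed.

End expectation.

(** * Conditioning on finite histories *)

Section urn_expectation.
Context (R : realType) (V : finType) (e : rel V) (B0 : V -> nat).
Context (d : measure_display) (T : measurableType d) (P : probability T R).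
Context (D : T -> trajectory V).
Hypothesis D_urn : is_urn_process e B0 P D.
Variable i0 : V.

(** Plays the part of measurability with respect to the first [n] steps; values off the edges are
    ignored. *)
Definition adapted (A : Type) n (F : trajectory V -> A) :=
  forall h h' : trajectory V, (forall k a, (k < n)%N -> a \in edges e -> h k a = h' k a) -> F h = F h'.

Lemma balls_adapted n i : adapted n (fun h => balls e B0 h n i).
Proof.
move=> h h' hh'; congr addn; apply: eq_bigr => k _; apply: eq_card => a.
by rewrite !inE; case: (boolP (a \in edges e)) => //= aE; rewrite hh'.
Qed.

(* Histories up to step [n] are coded by a finite type, with the junk value
   [i0] outside the edges. *)
Definition code n (h : trajectory V) : {ffun 'I_n * {set V} -> V} :=
  [ffun p : 'I_n * {set V} => if p.2 \in edges e then h p.1 p.2 else i0].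

Definition decode n (c : {ffun 'I_n * {set V} -> V}) : trajectory V :=
  fun k a => if insub k is Some k' then c (k', a) else i0.

Lemma decode_code n h k a : (k < n)%N -> a \in edges e ->
  decode (code n h) k a = h k a.
Proof.
by move=> kn aE; rewrite /decode insubT ffunE /= aE.
Qed.

Lemma adapted_decode (A : Type) n (F : trajectory V -> A) h : adapted n F ->
  F (decode (code n h)) = F h.
Proof. by apply=> k a kn aE; rewrite decode_code. Qed.

Definition atom n (c : {ffun 'I_n * {set V} -> V}) : set T :=
  [set w | code n (D w) = c].

(** A code with wrong junk values off the edges has an empty atom even if the history it decodes to
    occurs, hence the disjunction. *)
Lemma atomE n (c : {ffun 'I_n * {set V} -> V}) :
  atom c = history e D n (decode c) \/ atom c = set0.
Proof.
have [[w wc]|nc] := pselect (exists w, code n (D w) = c); [left|right]; last first.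
  by apply/seteqP; split => // w wc; apply: nc; exists w.
apply/seteqP; split => [w' /= <- k a kn aE|w' /= w'c].
  by rewrite decode_code.
apply/ffunP => -[k a]; rewrite -wc !ffunE/=; case: ifPn => // aE.
by rewrite w'c// -wc decode_code.
Qed.

Lemma measurable_history n h : measurable (history e D n h).
Proof.
have -> : history e D n h =
    \bigcap_(p in [set p : 'I_n * {set V} | p.2 \in edges e])
      goes_to D p.1 p.2 (h p.1 p.2).
  apply/seteqP; split => [w wh [k a] /= aE|w wh k a kn aE]; first exact: wh.
  exact: (wh (Ordinal kn, a)).
apply: fin_bigcap_measurable; first exact: finite_finset.
by move=> [k a] /= aE; exact: (urn_measurable D_urn).
Qed.

Lemma measurable_atom n (c : {ffun 'I_n * {set V} -> V}) : measurable (atom c).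
Proof.
case: (atomE c) => ->; last exact: measurable0.
exact: measurable_history.
Qed.

Lemma adapted_sum_atoms n (F : trajectory V -> R) w : adapted n F ->
  F (D w) = \sum_(c : {ffun 'I_n * {set V} -> V}) F (decode c) * \1_(atom c) w.
Proof.
move=> adF; rewrite (bigD1 (code n (D w)))//= big1 ?addr0 => [|c cw].
  by rewrite indicE mem_set// mulr1 adapted_decode.
rewrite indicE memNset ?mulr0// /atom/= => wc.
by rewrite wc eqxx in cw.
Qed.

Lemma adapted_integrable n (F : trajectory V -> R) : adapted n F ->
  P.-integrable setT (EFin \o (F \o D)).
Proof.
move=> adF.
have -> : F \o D = (fun w =>
    \sum_(c : {ffun 'I_n * {set V} -> V}) F (decode c) * \1_(atom c) w).
  by apply/funext => w /=; exact: adapted_sum_atoms.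
apply: (proj1 (Rintegral_sum_indic _ _ _)) => c; exact: measurable_atom.
Qed.

(** The tower property for one edge: on each of the finitely many atoms [F] is constant and the
    conditional probability is the prescribed one. *)
Lemma expectation_goes_to n (F : trajectory V -> R) i j : adapted n F -> e i j ->
  P.-integrable setT
    (EFin \o (fun w => F (D w) * (D w n [set i; j]%SET == i)%:R)) /\
  \int[P]_w (F (D w) * (D w n [set i; j]%SET == i)%:R) =
  \int[P]_w (F (D w) * ((balls e B0 (D w) n i)%:R /
    ((balls e B0 (D w) n i)%:R + (balls e B0 (D w) n j)%:R))).
Proof.
move=> adF eij; set p := fun h => (balls e B0 h n i)%:R /
    ((balls e B0 h n i)%:R + (balls e B0 h n j)%:R) : R.
have adFp : adapted n (fun h => F h * p h).
  by move=> h h' hh'; rewrite /p (adF _ _ hh') !(balls_adapted _ hh').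
pose G := goes_to D n [set i; j]%SET i.
have ijE : [set i; j]%SET \in edges e.
  by apply/imsetP; exists (i, j); rewrite ?inE.
have mG : measurable G by exact: (urn_measurable D_urn).
have -> : (fun w => F (D w) * (D w n [set i; j]%SET == i)%:R) = (fun w =>
    \sum_(c : {ffun 'I_n * {set V} -> V}) F (decode c) * \1_(atom c `&` G) w).
  apply/funext => w; rewrite (adapted_sum_atoms w adF) mulr_suml.
  apply: eq_bigr => c _; rewrite -mulrA indicI/=; congr (_ * (_ * _)).
  rewrite indicE; congr (_ %:R); congr nat_of_bool.
  by apply/eqP/idP => [wG|/set_mem]//; exact: mem_set.
pose history_code := {ffun 'I_n * {set V} -> V}.
have mAG (c : history_code) : measurable (atom c `&` G).
  by apply: measurableI => //; exact: measurable_atom.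
have [int_G int_GE] := Rintegral_sum_indic P (fun c => F (decode c)) mAG.
split=> //; rewrite int_GE.
under [RHS]eq_Rintegral => w _ do rewrite (adapted_sum_atoms w adFp).
have mA (c : history_code) : measurable (atom c) by exact: measurable_atom.
have [_ ->] := Rintegral_sum_indic P (fun c => F (decode c) * p (decode c)) mA.
apply: eq_bigr => c _; rewrite -mulrA; congr (_ * _).
have fin_P A : measurable A -> P A \is a fin_num by exact: fin_num_measure.
(* The prescription covers only histories of positive probability; null atoms contribute 0 to both
   sides. *)
have [P0|P0] := eqVneq (P (atom c)) 0%E.
  have PG0 : P (atom c `&` G) = 0%E.
    apply/eqP; rewrite -measure_le0 -P0.
    by apply: le_measure; rewrite ?inE//.
  by rewrite P0 PG0 /= mulr0.
have {P0} Pgt0 : (0 < P (atom c))%E by rewrite lt0e P0 measure_ge0.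
have [atomc|atom0] := atomE c; last by rewrite atom0 measure0 ltxx in Pgt0.
have := @urn_cond_prob _ _ _ _ _ _ _ _ D_urn n (decode c) i j eij.
rewrite -atomc => /(_ Pgt0).
rewrite /cond_prob -/G setIC -/(p (decode c)) => <-.
by rewrite divfK// fine_eq0 ?gt_eqF// fin_P//; exact: measurable_atom.
Qed.

End urn_expectation.

(** * Almost sure convergence *)

Section urn_convergence.
Context (R : realType) (V : finType) (e : rel V) (B0 : V -> nat).
Context (d : measure_display) (T : measurableType d) (P : probability T R).
Context (D : T -> trajectory V) (i0 : V) (v : V -> R).
Hypotheses (e_simple : simple_graph e) (B0_ge1 : forall i, (1 <= B0 i)%N).
Hypothesis D_urn : is_urn_process e B0 P D.
Hypotheses (v_ge0 : forall i, 0 <= v i) (sum_v : \sum_i v i = 1).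
Hypothesis v_gt0 : forall i j, e i j -> 0 < v i + v j.
Hypothesis v_eq : forall i, 2 * \sum_(j | e i j) (v i + v j)^-1
  <= (\sum_i \sum_(j | e i j) 1%N)%N%:R.

Local Notation S n := ((total e B0 n)%:R : R).
Local Notation ball h n i := ((balls e B0 h n i)%:R : R).
Local Notation x := (share R e B0).

Definition discrepancy (h : trajectory V) n : R :=
  \sum_i \sum_(j | e i j) (S n)^-1 * ((x h n i + x h n j) - (v i + v j)) ^+ 2.

(* The conditional expectation of [realized] given the first [n] steps. *)
Definition expected (h : trajectory V) n : R :=
  \sum_i \sum_(j | e i j) v i / (ball h n i + ball h n j).

(** First-order increment of [sum_i v i * ln (ball h n i)] during step [n.+1]. *)
Definition realized (h : trajectory V) n : R :=
  \sum_i \sum_(j | e i j) v i / ball h n i * (h n [set i; j]%SET == i)%:R.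

Let S_gt0 n : 0 < S n. Proof. exact: total_gt0. Qed.

Let ball_gt0 h n i : 0 < ball h n i. Proof. exact: balls_gt0. Qed.

(** The equilibrium gap for the shares, divided by [S n]: passing from shares to ball counts brings
    a factor [S n], and half the number of adjacent ordered pairs is the number of edges. *)
Lemma discrepancy_le h n :
  discrepancy h n <= 8 * (expected h n - #|edges e|%:R / S n).
Proof.
have [esym _] := e_simple.
have v_le1 i : v i <= 1 by rewrite -sum_v (bigD1 i)//= lerDl sumr_ge0.
have x_gt0 i : 0 < x h n i by exact: share_gt0.
have x_le1 i : x h n i <= 1 by exact: share_le1.
have := equilibrium_gap esym v_le1 x_le1 (fun i => ltW (x_gt0 i))
  (sum_share _ _ B0_ge1 i0 h n) v_gt0
  (fun i j _ => addr_gt0 (x_gt0 i) (x_gt0 j)) v_eq.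
rewrite (sum_adjacent_pairs e_simple i0) natrM mulrAC divff ?pnatr_eq0// mul1r.
have -> : \sum_i \sum_(j | e i j) v i / (x h n i + x h n j) = S n * expected h n.
  rewrite mulr_sumr; apply: eq_bigr => i _; rewrite mulr_sumr.
  apply: eq_bigr => j _; rewrite /share.
  have := ball_gt0 h n i; have := ball_gt0 h n j; have := S_gt0 n.
  move: (ball h n i) (ball h n j) (S n) => bi bj s s0 bj0 bi0.
  by field; rewrite !gt_eqF// addr_gt0// mulr_gt0.
have -> : discrepancy h n =
    (S n)^-1 * \sum_i \sum_(j | e i j) ((x h n i + x h n j) - (v i + v j)) ^+ 2.
  by rewrite mulr_sumr; apply: eq_bigr => i _; rewrite mulr_sumr.
move: (\sum_i _) (expected h n) => Q E gap.
rewrite ler_pdivrMl//.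
have -> : S n * (8 * (E - #|edges e|%:R / S n)) = 8 * (S n * E - #|edges e|%:R).
  by field; rewrite gt_eqF.
by rewrite -ler_pdivrMl//.
Qed.

Lemma discrepancy_adapted n : adapted e n (fun h => discrepancy h n).
Proof.
move=> h h' hh'; apply: eq_bigr => i _; apply: eq_bigr => j _.
by rewrite /share !(balls_adapted B0 _ hh').
Qed.

Lemma expected_adapted n : adapted e n (fun h => expected h n).
Proof.
move=> h h' hh'; apply: eq_bigr => i _; apply: eq_bigr => j _.
by rewrite !(balls_adapted B0 _ hh').
Qed.

(** By linearity each adjacent pair is treated alone; the numerator [ball h n i] of the conditional
    probability cancels the denominator in [realized]. *)
Lemma expectation_realized n :
  P.-integrable setT (EFin \o (fun w => realized (D w) n)) /\
  \int[P]_w realized (D w) n = \int[P]_w expected (D w) n.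
Proof.
have adv i : adapted e n (fun h => v i / ball h n i).
  by move=> h h' hh'; rewrite (balls_adapted B0 _ hh').
have adv2 i j : adapted e n (fun h => v i / (ball h n i + ball h n j)).
  by move=> h h' hh'; rewrite !(balls_adapted B0 _ hh').
have step i j (eij : e i j) := expectation_goes_to D_urn i0 (adv i) eij.
have int_i i : P.-integrable setT (EFin \o (fun w =>
    \sum_(j | e i j) v i / ball (D w) n i * (D w n [set i; j]%SET == i)%:R)).
  by apply: integrable_sumR => j eij; exact: (step i j eij).1.
split; first by apply: integrable_sumR => i _.
rewrite [LHS]Rintegral_sum; last by move=> i _.
rewrite [RHS]Rintegral_sum; last first.
  move=> i _; apply: integrable_sumR => j eij.
  exact: (adapted_integrable D_urn i0 (adv2 i j)).
apply: eq_bigr => i _.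
rewrite [LHS]Rintegral_sum; last by move=> j eij; exact: (step i j eij).1.
rewrite [RHS]Rintegral_sum; last first.
  by move=> j eij; exact: (adapted_integrable D_urn i0 (adv2 i j)).
apply: eq_bigr => j eij; rewrite (step i j eij).2.
apply: eq_Rintegral => w _; rewrite mulrA divfK// gt_eqF//; exact: ball_gt0.
Qed.

Lemma sum_realized_le w n :
  \sum_(k < n) (realized (D w) k - #|edges e|%:R / S k)
    <= ln (S 0%N) + #|edges e|%:R.
Proof.
apply: le_trans _ (potential_le e B0_ge1 i0 (D w) n v_ge0 sum_v).
apply: ler_sum => k _; rewrite lerD2r le_eqVlt; apply/orP; left; apply/eqP.
apply: eq_bigr => i _; rewrite -mulr_sumr -mulrA; congr (_ * _).
rewrite mulrC; congr (_ / _).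
by rewrite /gain card_edges_to ?natr_sum// => a; exact: (urn_endpoint D_urn).
Qed.

(** Bound [discrepancy] by the expected drift, exchange [expected] for [realized] under the
    integral, then apply the pathwise bound, uniform in [n]. *)
Lemma expectation_sum_discrepancy_le n :
  \int[P]_w (\sum_(k < n) discrepancy (D w) k)
    <= 8 * (ln (S 0%N) + #|edges e|%:R).
Proof.
have int_disc k := adapted_integrable D_urn i0 (@discrepancy_adapted k).
have int_exp k := adapted_integrable D_urn i0 (@expected_adapted k).
have int_cst (c : R) : P.-integrable setT (EFin \o (fun=> c)).
  exact: finite_measure_integrable_cst.
have int_real k := (expectation_realized k).1.
have int_B (f : T -> R) c : P.-integrable setT (EFin \o f) ->
    P.-integrable setT (EFin \o (fun w => f w - c)).
  by move=> int_f; apply: eq_integrable (integrableB measurableT int_f (int_cst c)).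
pose N_S k : R := #|edges e|%:R / S k.
apply: (@le_trans _ _ (8 * \int[P]_w \sum_(k < n) (realized (D w) k - N_S k))).
  rewrite Rintegral_sum => [|k _]; last exact: int_disc.
  rewrite Rintegral_sum => [|k _]; last exact: int_B.
  rewrite mulr_sumr; apply: ler_sum => k _.
  rewrite RintegralB//.
  rewrite (expectation_realized k).2 -RintegralB//; last exact: int_exp.
  rewrite -RintegralZl//; last by apply: int_B; exact: int_exp.
  apply: le_Rintegral => //; last by move=> w _; exact: discrepancy_le.
    exact: int_disc.
  have int_expB := int_B _ (N_S k) (int_exp k).
  by apply: eq_integrable (integrableZl measurableT 8 int_expB).
rewrite ler_pM2l//.
have := Rintegral_cst P measurableT (ln (S 0%N) + #|edges e|%:R).
rewrite [X in fine X](probability_setT P)/= mulr1 => <-.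
apply: le_Rintegral => //; last by move=> w _; exact: sum_realized_le.
by apply: integrable_sumR => k _; exact: int_B.
Qed.

Lemma edge_shares_cvg : {ae P, forall w, forall i j, e i j ->
  (fun n => (x (D w) n i - v i) + (x (D w) n j - v j)) @ \oo --> (0 : R)}.
Proof.
have disc_ge0 h k i j : 0 <= (S k)^-1 * ((x h k i + x h k j) - (v i + v j)) ^+ 2.
  by rewrite mulr_ge0 ?sqr_ge0// invr_ge0 ltW.
have := ae_series_cvg
  (fun k => adapted_integrable D_urn i0 (@discrepancy_adapted k))
  (fun k w => sumr_ge0 _ (fun i _ => sumr_ge0 _ (fun j _ => disc_ge0 (D w) k i j)))
  expectation_sum_discrepancy_le.
apply: filterS => w cvg_disc i j eij.
apply: (edge_share_cvg B0_ge1 i0 eij).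
apply: series_le_cvg cvg_disc => k //.
  by apply: sumr_ge0 => *; apply: sumr_ge0 => *.
(* The term of the single pair [i], [j] is dominated by the whole discrepancy. *)
rewrite /= /discrepancy (bigD1 i)//=; apply: ler_wpDr.
  by apply: sumr_ge0 => *; apply: sumr_ge0 => *.
by rewrite (bigD1 j)//= lerDl; apply: sumr_ge0 => *.
Qed.

Lemma shares_cvg : connected_graph e -> ~ balanced_bipartite e ->
  {ae P, forall w, forall i, x (D w) n i @[n --> \oo] --> v i}.
Proof.
move=> conn nbb; apply: filterS edge_shares_cvg => w edge_cvg i.
have := @edge_sums_cvg0 R V e (fun i n => x (D w) n i - v i) _ edge_cvg conn nbb i.
move=> /(_ _)/subr_cvg0; apply => n.
by rewrite sumrB sum_v (sum_share R _ B0_ge1 i0) subrr.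
Qed.

End urn_convergence.

Theorem theorem1p1 (R : realType) (m : nat) (e : rel 'I_m)
    (e_simple : simple_graph e) (e_connected : connected_graph e)
    (e_not_balanced : ~ balanced_bipartite e) :
  exists v : 'rV[R]_m,
    forall (B0 : 'I_m -> nat) (B0_ge1 : forall i : 'I_m, (1 <= B0 i)%N)
      (d : measure_display) (T : measurableType d) (P : probability T R)
      (D : T -> trajectory 'I_m) (D_urn : is_urn_process e B0 P D),
    {ae P, forall w : T,
      (fun n : nat => proportions R e B0 (D w) n) @ \oo --> v}.
Proof.
(* The empty graph is balanced-bipartite with two empty classes, so a vertex exists. *)
have [i0 _|no_vertex] := pickP (@predT 'I_m); last first.
  exfalso; apply: e_not_balanced; exists finset.set0, finset.set0.
  by split=> //; [apply/setP => i|apply/setP => i|move=> i]; have := no_vertex i.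
have [esym eirr] := e_simple.
have [v [[v_ge0 sum_v] v_gt0 v_eq]] := exists_equilibrium R i0 esym eirr.
(* The point is fixed before the initial balls, the probability space and the process. *)
exists v => B0 B0_ge1 d T P D D_urn.
have := shares_cvg i0 e_simple B0_ge1 D_urn v_ge0 sum_v v_gt0 v_eq
  e_connected e_not_balanced.
apply: filterS => w cvg_w; apply: cvg_rVP => i.
by under eq_cvg do rewrite mxE; exact: cvg_w.
Qed.
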